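(* Let $D$ be an integral domain. Then (equalities being equalities of semistar operations on $D$): (1) $d=d_a$ if and only if $D$ is a Prüfer domain; (2) $w=w_a$ if and only if $D$ is a P$v$MD; (3) $t=t_a$ if and only if $D$ is a $v$-domain.
   Context: Let $D$ be an integral domain with quotient field $K$; $\overline{\boldsymbol{F}}(D)$ denotes the set of nonzero $D$-submodules of $K$, $\boldsymbol{f}(D)$ the nonzero finitely generated fractional ideals. For $D$-submodules $A,B$ of $K$, $(A:B):=\{x\in K\mid xB\subseteq A\}$; $E^{-1}:=(D:E)$. A semistar operation on $D$ is a map $\star:\overline{\boldsymbol F}(D)\to\overline{\boldsymbol F}(D)$ such that for $0\ne z\in K$ and $E,F\in\overline{\boldsymbol F}(D)$: $(zE)^\star=zE^\star$; $E\subseteq F\Rightarrow E^\star\subseteq F^\star$; $E\subseteq E^\star=(E^\star)^\star$. For $E\in\overline{\boldsymbol F}(D)$: $E^d:=E$; $E^v:=(D:(D:E))$; $E^t:=\bigcup\{F^v\mid F\in\boldsymbol f(D), F\subseteq E\}$; $E^w:=\bigcap\{ED_Q\mid Q\in\mathrm{Max}^t(D)\}$ (an empty intersection being $K$), where $\mathrm{Max}^t(D)$ is the set of maximal elements among proper nonzero ideals $I$ of $D$ with $I^t=I$. For a semistar operation $\star$ on $D$, $\star_a$ is the semistar operation given by $F^{\star_a}:=\bigcup\{((FH)^\star:H^\star)\mid H\in\boldsymbol f(D)\}$ for $F\in\boldsymbol f(D)$ and $E^{\star_a}:=\bigcup\{F^{\star_a}\mid F\in\boldsymbol f(D),F\subseteq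 E\}$ for $E\in\overline{\boldsymbol F}(D)$. $D$ is a $v$-domain if $(FF^{-1})^v=D$ for all $F\in\boldsymbol f(D)$ (equivalently, $v$ is e.a.b.: $(FG)^v\subseteq(FH)^v$ implies $G^v\subseteq H^v$ for $F,G,H\in\boldsymbol f(D)$), and a P$v$MD (Prüfer $v$-multiplication domain) if $(FF^{-1})^t=D$ for all $F\in\boldsymbol f(D)$. *)

(* Defs.v *)
From HB Require Import structures.
From mathcomp Require Import all_boot all_order all_algebra.
From mathcomp Require Import boolp classical_sets.

Set Implicit Arguments.
Unset Strict Implicit.
Unset Printing Implicit Defensive.
Import GRing.Theory.
Local Open Scope classical_set_scope.
Local Open Scope ring_scope.

Section Semistar.
Variable D : idomainType.
Local Notation K := {fraction D}.
Local Notation "x %:F" := (@FracField.tofrac D x).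
Implicit Types (E F G H A B I Q X : set K) (star : set K -> set K).

(* D is identified with its image in K; accordingly an ideal of D is a
   D-submodule of K contained in base. *)
Definition base : set K := range (fun a : D => a%:F).

Definition submodule E : Prop :=
  [/\ E 0, forall x y, E x -> E y -> E (x + y)
    & forall (a : D) x, E x -> E (a%:F * x)].

Definition Fbar : set (set K) :=
  [set E | submodule E /\ exists2 x, E x & x != 0].

Definition span X : set K := smallest submodule X.

(* A finitely generated D-submodule of K is automatically a fractional ideal:
   the product of the denominators of its generators sends it into D. *)
Definition fg : set (set K) :=
  [set F | Fbar F /\ exists s : seq K, F = span [set` s]].

Definition mulm A B : set K := span [set x * y | x in A & y in B].

Definition colon A B : set K := [set x | forall y, B y -> A (x * y)].

Definition invm E : set K := colon base E.

Definition scale (z : K) E : set K := [set z * x | x in E].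

Definition is_semistar star : Prop :=
  [/\ forall E, Fbar E -> Fbar (star E),
      forall z E, z != 0 -> Fbar E -> star (scale z E) = scale z (star E),
      forall E F, Fbar E -> Fbar F -> E `<=` F -> star E `<=` star F
    & forall E, Fbar E -> E `<=` star E /\ star (star E) = star E].

(* Semistar operations are encoded as maps on all subsets of K; only their
   values on Fbar are meaningful, so they are compared there. *)
Definition semistar_eq (star1 star2 : set K -> set K) : Prop :=
  forall E, Fbar E -> star1 E = star2 E.

Definition d_op E : set K := E.

Definition v_op E : set K := colon base (colon base E).

Definition t_op E : set K :=
  \bigcup_(F in [set F | fg F /\ F `<=` E]) v_op F.

Definition t_ideal : set (set K) :=
  [set I | [/\ Fbar I, I `<=` base, I <> base & t_op I = I]].

Definition Max_t : set (set K) :=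
  [set Q | t_ideal Q /\ forall I, t_ideal I -> Q `<=` I -> I = Q].

Definition localize Q : set K :=
  [set x | exists a s : D, ~ Q s%:F /\ x = a%:F / s%:F].

Definition w_op E : set K := \bigcap_(Q in Max_t) mulm E (localize Q).

Definition a_fin star F : set K :=
  \bigcup_(H in fg) colon (star (mulm F H)) (star H).

(* By a_opE below, this agrees with a_fin on finitely generated modules. *)
Definition a_op star E : set K :=
  \bigcup_(F in [set F | fg F /\ F `<=` E]) a_fin star F.

Definition prufer_domain : Prop :=
  forall F, fg F -> mulm F (invm F) = base.

Definition v_domain : Prop :=
  forall F, fg F -> v_op (mulm F (invm F)) = base.

Definition pvmd : Prop :=
  forall F, fg F -> t_op (mulm F (invm F)) = base.

Lemma submodule_span X : submodule (span X).
Proof.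
split=> [M [[]]//|x y Ex Ey M MX|a x Ex M MX]; have [[_ MD MZ] _] := MX.
- by apply: MD; [exact: Ex | exact: Ey].
- by apply: MZ; exact: Ex.
Qed.

Lemma mulm_Fbar A B : Fbar A -> Fbar B -> Fbar (mulm A B).
Proof.
move=> [_ [x Ax x0]] [_ [y By y0]]; split; first exact: submodule_span.
exists (x * y); last by rewrite mulf_neq0.
by apply: sub_gen_smallest; exists x => //; exists y.
Qed.

Lemma a_opE star F : is_semistar star -> fg F -> a_op star F = a_fin star F.
Proof.
move=> [_ _ mono _] Ff; apply/seteqP; split=> [x [G [Gf GF] [H Hf xH]]|x xF].
  exists H => // y Hy; apply: mono (xH y Hy).
  - by apply: mulm_Fbar; [case: Gf | case: Hf].
  - by apply: mulm_Fbar; [case: Ff | case: Hf].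
  apply: smallest_sub; first exact: submodule_span.
  move=> _ [u Gu [w Hw <-]]; apply: sub_gen_smallest.
  by exists u; [exact: GF | exists w].
exists F => //; split=> //.
Qed.

End Semistar.

Arguments d_op {D} E.
Arguments v_op {D} E.
Arguments t_op {D} E.
Arguments w_op {D} E.

(* Main.v *)
Require Import Defs.
From mathcomp Require Import all_boot all_order all_algebra.
From mathcomp Require Import boolp classical_sets.
From mathcomp Require Import fraction generic_quotient ring.

(** Write F^-1 for (D : F), and say that a closure operation star is
cancellative when ((FH)^star : H^star) is contained in F^star for all finitely
generated F and H.  For an operation of finite type this is exactly
star = star_a, the inclusion of star in star_a being witnessed by H = D
(semistar_eq_a_opP).  So the three statements compare cancellation with
invertibility: 1 in (F F^-1)^star for every finitely generated F, where v
replaces star in the third one.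

Invertibility gives cancellation for every closure operation
(invertible_cancel): if x H^star lies in (FH)^star, then x (H H^-1) lies in
(F H H^-1)^star, hence in F^star, and closing once more puts x in F^star.

For the converse in the case of t, if y F F^-1 lies in D, then y F^v lies in
F^v = (DF)^v, so cancellation gives y in D^v = D; this says that (F F^-1)^v is
D (t_cancel_invertible).  This only controls divisorial closures and is too
weak for d and w.  These two operations are however stable: x in E^star
implies that the conductor {d in D | dx in E} is dense, in the sense that its
closure contains 1.  For stable operations the classical proof that a domain
with cancellation of finitely generated ideals is Pruefer works inside a dense
ideal.  Since u (1,u) lies in (1,u^2)(1,u), cancellation gives u in
(1,u^2)^star, so a dense set of d in D satisfies du = p + q u^2 with p and q in
D.  Then qu is a root of X^2 - dX + pq, and D is integrally closed because
D^star = D, so qu is in D.  Hence q and d - qu are both in (1,u)^-1 and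
d = u q + 1 (d - qu) is in (1,u)(1,u)^-1.  This is stable_cancel_pair, and
invertible_span passes from pairs to any number of generators.

It remains to see that w is a stable closure operation of finite type and that
it has the same dense ideals as t.  Both come from Zorn's lemma and the
primality of maximal t-ideals: an ideal whose t-closure does not contain 1 lies
in a maximal t-ideal (Max_t_above). *)

Set Implicit Arguments.
Unset Strict Implicit.
Unset Printing Implicit Defensive.
Import GRing.Theory.

Section FinitelyGenerated.
Local Open Scope classical_set_scope.
Local Open Scope ring_scope.
Variable D : idomainType.
Local Notation K := {fraction D}.
Local Notation "x %:F" := (@FracField.tofrac D x).
Local Notation base := (@base D).
Local Notation fg := (@fg D).
Local Notation Fbar := (@Fbar D).
Local Notation span := (@Defs.span D).
Implicit Types (A B E F G H I Q X : set K) (x y z u d e : K) (s : seq K).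

(** * Submodules of the quotient field *)

Lemma base1 : base 1.
Proof. by exists 1; rewrite ?tofrac1. Qed.

Lemma base_submodule : submodule base.
Proof.
split=> [|_ _ [a _ <-] [b _ <-]|a _ [b _ <-]].
- by exists 0; rewrite ?tofrac0.
- by exists (a + b); rewrite ?tofracD.
- by exists (a * b); rewrite ?tofracM.
Qed.

Lemma base_Fbar : Fbar base.
Proof.
split; first exact: base_submodule.
by exists 1; [exact: base1 | exact: oner_neq0].
Qed.

Lemma submoduleM E d x : submodule E -> base d -> E x -> E (d * x).
Proof. by move=> [_ _ EZ] [a _ <-]; exact: EZ. Qed.

Lemma submoduleB E x y : submodule E -> E x -> E y -> E (x - y).
Proof.
move=> Es Ex Ey; have [_ ED EZ] := Es; apply: ED => //.
by rewrite -mulN1r -tofrac1 -tofracN; apply: EZ.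
Qed.

Lemma submodule_transport E z : submodule E -> submodule [set a | E (z * a)].
Proof.
move=> [E0 ED EZ]; split=> /= [|x y Ex Ey|a x Ex]; first by rewrite mulr0.
  by rewrite mulrDr; exact: ED.
by rewrite mulrCA; exact: EZ.
Qed.

Lemma span_sub X E : submodule E -> X `<=` E -> span X `<=` E.
Proof. exact: smallest_sub. Qed.

Lemma sub_span X : X `<=` span X.
Proof. exact: sub_gen_smallest. Qed.

Lemma mulmI A B x y : A x -> B y -> mulm A B (x * y).
Proof. by move=> Ax By; apply: sub_span; exists x => //; exists y. Qed.

Lemma mulm_sub A B E : submodule E ->
  (forall x y, A x -> B y -> E (x * y)) -> mulm A B `<=` E.
Proof.
by move=> Es AB; apply: span_sub => // _ [x Ax [y By <-]]; exact: AB.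
Qed.

Lemma mulm_base F : submodule F -> mulm base F = F.
Proof.
move=> Fs; apply/seteqP; split=> [|x Fx].
  by apply: mulm_sub => // x y; exact: submoduleM.
by rewrite -[x]mul1r; apply: mulmI => //; exact: base1.
Qed.

Lemma invm_submodule E : submodule (invm E).
Proof.
have [b0 bD bZ] := base_submodule.
split=> [y _|x y xE yE e Ee|a x xE e Ee]; first by rewrite mul0r.
  by rewrite mulrDl; apply: bD; [exact: xE | exact: yE].
by rewrite -mulrA; apply/bZ/xE.
Qed.

Lemma invm_span X x : (forall y, X y -> base (x * y)) -> invm (span X) x.
Proof.
move=> xX; apply: (@span_sub X [set y | base (x * y)]) => //.
exact: submodule_transport base_submodule.
Qed.

Lemma mulm_invm_sub E : mulm E (invm E) `<=` base.
Proof.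
apply: mulm_sub base_submodule _ => x y Ex; rewrite mulrC; exact.
Qed.

Lemma span_pair a b x : span [set` [:: a; b]] x ->
  exists p q, [/\ base p, base q & x = p * a + q * b].
Proof.
have [b0 bD bZ] := base_submodule.
move: x; pose E := [set x | exists p q,
  [/\ base p, base q & x = p * a + q * b]].
apply: (@span_sub _ E) => [|y /=]; last first.
  rewrite !inE => /orP[] /eqP ->; [exists 1, 0|exists 0, 1];
    split; rewrite ?mul1r ?mul0r ?addr0 ?add0r //; exact: base1.
split=> [|y z [p [q [bp bq ->]]] [p' [q' [bp' bq' ->]]]|c y [p [q [bp bq ->]]]].
- by exists 0, 0; split; rewrite ?mul0r ?addr0.
- by exists (p + p'), (q + q'); split; [exact: bD|exact: bD|ring].
- by exists (c%:F * p), (c%:F * q); split; [exact: bZ|exact: bZ|ring].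
Qed.

Lemma span_neq0 s x : span [set` s] x -> x != 0 -> exists2 y, y \in s & y != 0.
Proof.
move=> sx x0; apply: contrapT => s0; case/eqP: x0; move: x sx.
apply: (@span_sub _ [set 0]) => [|y /= ys].
  split=> //= [x y -> ->|a x ->]; [by rewrite addr0|by rewrite mulr0].
by apply: contrapT => /eqP y0; apply: s0; exists y.
Qed.

Lemma fg_Fbar F : fg F -> Fbar F.
Proof. by case. Qed.

Lemma fg_span s y : y \in s -> y != 0 -> fg (span [set` s]).
Proof.
move=> ys y0; split; last by exists s.
by split; [exact: submodule_span | exists y => //; exact: sub_span].
Qed.

Lemma base_fg : fg base.
Proof.
split; first exact: base_Fbar.
exists [:: 1]; apply/seteqP; split=> [_ [a _ <-]|].
  rewrite -[a%:F]mulr1; have [_ _ sZ] := submodule_span [set` [:: 1 : K]].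
  by apply: sZ; apply: sub_span; rewrite /= inE.
apply: span_sub base_submodule _ => y /=; rewrite inE => /eqP ->.
exact: base1.
Qed.

(** A nonzero element of E is added to the list, so that the span is nonzero
even when the given elements are not. *)
Lemma fg_containing E s : Fbar E -> (forall y, y \in s -> E y) ->
  exists F, [/\ fg F, F `<=` E & forall y, y \in s -> F y].
Proof.
move=> [Es [e Ee e0]] sE; exists (span [set` e :: s]); split.
- by apply: fg_span e0; rewrite mem_head.
- by apply: span_sub => // y /=; rewrite inE => /orP[/eqP -> //|]; exact: sE.
- by move=> y ys; apply: sub_span; rewrite /= inE ys orbT.
Qed.

Lemma fg_directed E F G : Fbar E -> fg F -> fg G -> F `<=` E -> G `<=` E ->
  exists H, [/\ fg H, H `<=` E, F `<=` H & G `<=` H].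
Proof.
move=> EF [_ [s ->]] [_ [s' ->]] sE s'E.
have [|H [Hf HE ssH]] := @fg_containing E (s ++ s') EF.
  move=> y; rewrite mem_cat => /orP[] ys; [apply: sE|apply: s'E];
    exact: sub_span.
have [Hs _] := fg_Fbar Hf.
by exists H; split=> //; apply: span_sub => // y /= ys; apply: ssH;
  rewrite mem_cat ys ?orbT.
Qed.

Lemma seq_directed (C : set (set K)) s : C !=set0 ->
  (forall A B, C A -> C B -> exists G, [/\ C G, A `<=` G & B `<=` G]) ->
  (forall y, y \in s -> exists2 A, C A & A y) ->
  exists2 A, C A & forall y, y \in s -> A y.
Proof.
move=> [A0 CA0] dirC; elim: s => [|x s IH] sC; first by exists A0.
have [|A CA sA] := IH.
  by move=> y ys; apply: sC; rewrite inE ys orbT.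
have [B CB Bx] := sC x (mem_head _ _).
have [G [CG AG BG]] := dirC A B CA CB.
exists G => // y; rewrite inE => /orP[/eqP ->|/sA]; [exact: BG|exact: AG].
Qed.

Lemma fraction_denominator x :
  exists n, exists2 m : D, m != 0 & m%:F * x = n%:F.
Proof.
elim/quotW: x => r; exists \n_r, \d_r; first exact: denom_ratioP.
rewrite -[LHS]/(FracField.mul _ _) !piE.
apply/eqmodP.
rewrite /= FracField.equivfE /FracField.mulf.
by rewrite !numden_Ratio ?mulf_neq0 ?oner_eq0 ?denom_ratioP // mulr1 mul1r.
Qed.

(** The product of the denominators of the generators sends F into D. *)
Lemma invm_Fbar F : fg F -> Fbar (invm F).
Proof.
move=> [_ [s ->]]; split; first exact: invm_submodule.
have [a a0 sa] : exists2 a : D, a != 0 & forall y, y \in s -> base (a%:F * y).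
  elim: s => [|x s [a a0 sa]]; first by exists 1; rewrite ?oner_neq0.
  have [n [m m0 xE]] := fraction_denominator x.
  exists (a * m); first by rewrite mulf_neq0.
  move=> y; rewrite inE => /orP[/eqP ->|ys].
    by exists (a * n) => //; rewrite !tofracM -xE; ring.
  by rewrite tofracM (mulrC a%:F) -mulrA; apply: (submoduleM base_submodule);
    [exists m|exact: sa].
by exists a%:F; [exact: invm_span | rewrite tofrac_eq0].
Qed.


(** * Closure operations and cancellation *)

Definition conductor E x : set K := [set d | base d /\ E (d * x)].

(** The third clause gathers monotony, idempotence and compatibility with
multiplication by elements of the quotient field. *)
Definition closure_op (star : set K -> set K) : Prop :=
  [/\ forall E, Fbar E -> submodule (star E),
      forall E, Fbar E -> E `<=` star E,
      forall A E z x, Fbar A -> Fbar E -> star A x ->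
        (forall a, A a -> star E (z * a)) -> star E (z * x)
    & star base `<=` base].

Definition finite_type (star : set K -> set K) : Prop :=
  forall E x, Fbar E -> star E x -> exists F, [/\ fg F, F `<=` E & star F x].

Definition stable (star : set K -> set K) : Prop :=
  forall E x, Fbar E -> star E x -> star (conductor E x) 1.

Definition cancellative (star : set K -> set K) : Prop :=
  forall F H, fg F -> fg H -> colon (star (mulm F H)) (star H) `<=` star F.

Lemma closure_mono star A E : closure_op star -> Fbar A -> Fbar E ->
  A `<=` E -> star A `<=` star E.
Proof.
move=> [_ ext trans _] AF EF AE x Ax; rewrite -[x]mul1r.
by apply: trans Ax _ => // a /AE Ea; rewrite mul1r; exact: ext.
Qed.

Lemma closure_dense star A E x : closure_op star -> Fbar A -> Fbar E ->
  star A 1 -> (forall a, A a -> star E (x * a)) -> star E x.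
Proof.
by move=> [_ _ trans _] AF EF A1 AE; rewrite -[x]mulr1; exact: trans A1 _.
Qed.

Lemma semistar_eq_a_opP star : closure_op star -> finite_type star ->
  semistar_eq star (a_op star) <-> cancellative star.
Proof.
move=> cl fin; have [sub ext trans base_closed] := cl.
split=> [eq_a F H Ff Hf x xH|cancel E EF].
  by rewrite (eq_a F (fg_Fbar Ff)); exists F; [split|exists H].
apply/seteqP; split=> [x Ex|x [F [Ff FE] [H Hf /cancel Fx]]].
  have [F [Ff FE Fx]] := fin E x EF Ex; have [Fs _] := fg_Fbar Ff.
  exists F => //; exists base; first exact: base_fg.
  move=> y /base_closed by_; rewrite mulrC.
  apply: submoduleM => //.
    by apply: sub; exact: mulm_Fbar (fg_Fbar Ff) base_Fbar.
  apply: closure_mono Fx => //; [exact: fg_Fbar| |].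
    exact: mulm_Fbar (fg_Fbar Ff) base_Fbar.
  by move=> z Fz; rewrite -[z]mulr1; apply: mulmI => //; exact: base1.
by apply: (closure_mono cl (fg_Fbar Ff) EF FE); exact: Fx.
Qed.

(** Here x (H H^-1) lies in (F H H^-1)^star, which is inside F^star, and closing
once more gives x itself. *)
Lemma invertible_cancel star F H x : closure_op star -> fg F -> fg H ->
  star (mulm H (invm H)) 1 ->
  (forall h, H h -> star (mulm F H) (x * h)) -> star F x.
Proof.
move=> cl Ff Hf H1 xH; have [sub ext trans _] := cl.
have [FF HF] := (fg_Fbar Ff, fg_Fbar Hf); have [Fs _] := FF.
apply: closure_dense H1 _ => //; first exact: mulm_Fbar HF (invm_Fbar Hf).
apply: mulm_sub; first exact/submodule_transport/sub.
move=> h e Hh He; rewrite /= mulrA mulrC.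
apply: trans (xH h Hh) _ => //; first exact: mulm_Fbar.
apply: mulm_sub; first exact/submodule_transport/sub.
move=> f g Ff' Hg /=; apply: ext => //.
by rewrite mulrCA mulrC; apply: submoduleM => //; exact: He.
Qed.

(** The elements h with x h in (FH)^star form a submodule, and star is
idempotent; so cancellation by H can be tested on its generators. *)
Lemma cancel_span star F s y x : closure_op star -> cancellative star ->
  fg F -> y \in s -> y != 0 ->
  (forall h, h \in s -> star (mulm F (span [set` s])) (x * h)) -> star F x.
Proof.
move=> cl cancel Ff ys y0 xs; have [sub _ trans _] := cl.
have Hf := fg_span ys y0; have HF := fg_Fbar Hf.
have FHF := mulm_Fbar (fg_Fbar Ff) HF.
apply: (cancel F _ Ff Hf) => h; move/trans; apply => //.
by apply: span_sub xs; exact/submodule_transport/sub.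
Qed.

(** With H = (1,z) the equation gives z H inside H, so cancellation from D
puts z in the closure of D, which is D. *)
Lemma cancel_integrally_closed star z b c :
  closure_op star -> cancellative star -> base b -> base c ->
  z * z = b * z - c -> base z.
Proof.
move=> cl cancel bb bc zz; have [_ ext _ base_closed] := cl.
apply: base_closed.
have s1 : (1 : K) \in [:: 1; z] by rewrite mem_head.
have Hf := fg_span s1 (oner_neq0 _); have [Hs _] := fg_Fbar Hf.
apply: cancel_span cl cancel base_fg s1 (oner_neq0 _) _ => h hs.
apply: ext; first exact: mulm_Fbar base_Fbar (fg_Fbar Hf).
have H1 : span [set` [:: 1; z]] 1 by apply: sub_span; rewrite /= mem_head.
have Hz : span [set` [:: 1; z]] z.
  by apply: sub_span; rewrite /= !inE eqxx orbT.
rewrite mulm_base //; move: hs; rewrite !inE => /orP[] /eqP ->.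
  by rewrite mulr1.
rewrite zz; apply: (submoduleB Hs (submoduleM Hs bb Hz)).
by rewrite -[c]mulr1; exact: submoduleM Hs bc H1.
Qed.

Lemma conductor_Fbar E x : Fbar E -> Fbar (conductor E x).
Proof.
move=> [Es [e Ee e0]]; have [E0 ED EZ] := Es; have [b0 bD bZ] := base_submodule.
split.
  split=> [|y z [by_ Ey] [bz Ez]|a y [by_ Ey]]; first by split; rewrite ?mul0r.
    by split; [exact: bD|rewrite mulrDl; exact: ED].
  by split; [exact: bZ|rewrite -mulrA; exact: EZ].
have [n [m m0 mx]] := fraction_denominator x.
have [k [l l0 le]] := fraction_denominator e.
have k0 : k%:F != 0 :> K.
  by rewrite -le; apply: mulf_neq0 => //; rewrite tofrac_eq0.
exists (k%:F * m%:F); last by apply: mulf_neq0 => //; rewrite tofrac_eq0.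
split; first by apply: bZ; exists m.
by rewrite -mulrA mx -le mulrC; exact: EZ _ _ (EZ _ _ Ee).
Qed.

(** Writing b = u a reduces to (1,u).  Cancelling (1,u) puts u in (1,u^2)^star,
and stability turns this into honest relations d u = p + q u^2 for a dense set
of d; each of them exhibits d in (1,u)(1,u)^-1. *)
Lemma stable_cancel_pair star a b : closure_op star -> stable star ->
  cancellative star -> a != 0 ->
  star (mulm (span [set` [:: a; b]]) (invm (span [set` [:: a; b]]))) 1.
Proof.
move=> cl st cancel a0; have [sub ext trans _] := cl.
have [u uE] : exists u, b = u * a by exists (b / a); rewrite mulfVK.
have mem1 v : (1 : K) \in [:: 1; v] by rewrite mem_head.
have Hf v := fg_span (mem1 v) (oner_neq0 _).
have gen v : span [set` [:: 1; v]] 1 /\ span [set` [:: 1; v]] v.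
  by split; apply: sub_span; rewrite /= !inE eqxx ?orbT.
have Hu : star (span [set` [:: 1; u * u]]) u.
  apply: cancel_span cl cancel (Hf _) (mem1 u) (oner_neq0 _) _ => h hs.
  apply: ext; first exact: mulm_Fbar (fg_Fbar (Hf _)) (fg_Fbar (Hf _)).
  have [[g1 g2] [g3 g4]] := (gen (u * u), gen u).
  move: hs; rewrite !inE => /orP[] /eqP ->.
    by rewrite [u * 1]mulrC; exact: mulmI g1 g4.
  by rewrite -[X in mulm _ _ X]mulr1; exact: mulmI g2 g3.
have abf := fg_span (mem_head a [:: b]) a0.
have FF := mulm_Fbar (fg_Fbar abf) (invm_Fbar abf).
apply: closure_dense (st _ _ (fg_Fbar (Hf _)) Hu) _ => //.
  exact: conductor_Fbar (fg_Fbar (Hf _)).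
move=> d [bd /span_pair[p [q [bp bq du]]]]; rewrite mul1r; apply: ext => //.
(* q u is a root of X^2 - d X + p q *)
have bqu : base (q * u).
  have bpq := submoduleM base_submodule bp bq.
  apply: cancel_integrally_closed cl cancel bd bpq _.
  have -> : d * (q * u) = q * (d * u) by ring.
  by rewrite du; ring.
have -> : d = a * ((d - q * u) / a) + b * (q / a).
  rewrite uE mulrC mulfVK // -mulrA [a * _]mulrC mulfVK //.
  by rewrite [u * q]mulrC subrK.
have [_ FD _] := submodule_span
  [set x * y | x in span [set` [:: a; b]] & y in invm (span [set` [:: a; b]])].
apply: FD; apply: mulmI.
- by apply: sub_span; rewrite /= mem_head.
- apply: invm_span => y; rewrite /= !inE => /orP[] /eqP ->.
    by rewrite mulfVK //; exact: submoduleB base_submodule _ _.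
  rewrite uE [u * a]mulrC mulrA mulfVK // mulrBl du.
  by have -> : p * 1 + q * (u * u) - q * u * u = p by ring.
- by apply: sub_span; rewrite /= !inE eqxx orbT.
- apply: invm_span => y; rewrite /= !inE => /orP[] /eqP ->.
    by rewrite mulfVK.
  by rewrite uE [u * a]mulrC mulrA mulfVK.
Qed.

(** Induction on the generators, with F' = F + Db.  For a nonzero generator a of
F and e in F^-1, the element d = a e of F F^-1 sends g in (a,b)^-1 into F'^-1,
since d g b = (a e)(g b) and d g y = (g a)(e y) for y in F.  Hence
d (a,b)(a,b)^-1 lies in F' F'^-1, and d lies in its closure. *)
Lemma invertible_span star s y : closure_op star ->
  (forall a b, a != 0 ->
    star (mulm (span [set` [:: a; b]]) (invm (span [set` [:: a; b]]))) 1) ->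
  y \in s -> y != 0 ->
  star (mulm (span [set` s]) (invm (span [set` s]))) 1.
Proof.
move=> cl pairs; have [sub ext trans _] := cl.
elim: s y => [//|b s IH] y ys y0; have F'f := fg_span ys y0.
have F'F := mulm_Fbar (fg_Fbar F'f) (invm_Fbar F'f).
have mem_gen z : z \in b :: s -> span [set` b :: s] z.
  by move=> zs; exact: sub_span.
have [[z zs z0]|s0] := pselect (exists2 z, z \in s & z != 0); last first.
  (* all the other generators vanish, so F' = Db *)
  have yE z : z \in b :: s -> z != 0 -> z = b.
    rewrite inE => /orP[/eqP //|zs z0]; case: s0; by exists z.
  have b0 : b != 0 by rewrite -(yE y ys y0).
  apply: ext => //; rewrite -(divff b0); apply: mulmI.
    by apply: mem_gen; rewrite mem_head.
  apply: invm_span => z /= zs; have [->|z0] := eqVneq z 0.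
    by rewrite mulr0; have [] := base_submodule.
  by rewrite (yE z zs z0) mulVf; [exact: base1|].
have Ff := fg_span zs z0.
apply: closure_dense (IH z zs z0) _ => //.
  exact: mulm_Fbar (fg_Fbar Ff) (invm_Fbar Ff).
move=> c; rewrite mul1r; move: c.
have sF' := sub _ F'F.
apply: mulm_sub => // x e sx Fe.
rewrite mulrC; move: x sx; apply: (span_sub (submodule_transport e sF')).
move=> a /= as_.
have [->|a0] := eqVneq a 0; first by rewrite mulr0; have [] := sF'.
have abf := fg_span (mem_head a [:: b]) a0.
apply: closure_dense (pairs a b a0) _ => //.
  exact: mulm_Fbar (fg_Fbar abf) (invm_Fbar abf).
apply: mulm_sub; first exact: submodule_transport.
have Fea : base (e * a) by apply: Fe; exact: sub_span.
move=> f g abf' abg /=; apply: ext => //; rewrite mulrCA; apply: mulmI.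
  move: f abf'; apply: span_sub (submodule_span _) _ => f /=.
  rewrite !inE => /orP[] /eqP ->; apply: mem_gen;
    by rewrite !inE ?eqxx ?as_ ?orbT.
have ga : base (g * a) by apply: abg; apply: sub_span; rewrite /= !inE eqxx.
have gb : base (g * b).
  by apply: abg; apply: sub_span; rewrite /= !inE eqxx orbT.
apply: invm_span => h; rewrite /= inE => /orP[/eqP ->|hs].
  by rewrite -mulrA; exact: submoduleM base_submodule _ _.
have -> : e * a * g * h = (g * a) * (e * h) by ring.
apply: submoduleM base_submodule ga _; apply: Fe; exact: sub_span.
Qed.

Lemma stable_cancellativeP star : closure_op star -> stable star ->
  cancellative star <-> (forall F, fg F -> star (mulm F (invm F)) 1).
Proof.
move=> cl st; have [_ ext _ _] := cl.
split=> [cancel F [[_ [x Fx x0]] [s FE]]|inv F H Ff Hf x xH].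
  move: Fx; rewrite FE => /span_neq0 /(_ x0)[y ys y0].
  apply: (invertible_span cl _ ys y0) => a b.
  exact: stable_cancel_pair cl st cancel.
apply: (invertible_cancel cl Ff Hf (inv H Hf)) => h Hh.
apply: xH; exact: ext (fg_Fbar Hf) _ Hh.
Qed.


Lemma closure_eq_baseP star I : closure_op star -> Fbar I -> I `<=` base ->
  star I = base <-> star I 1.
Proof.
move=> cl IF Ib; have [sub ext _ base_closed] := cl; split=> [->|I1].
  exact: base1.
apply/seteqP; split=> x Ix.
  by apply/base_closed/(closure_mono cl IF base_Fbar Ib).
by rewrite -[x]mulr1; exact: submoduleM (sub I IF) Ix I1.
Qed.

Lemma mulm_invm_Fbar F : fg F -> Fbar (mulm F (invm F)).
Proof. by move=> Ff; exact: mulm_Fbar (fg_Fbar Ff) (invm_Fbar Ff). Qed.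

(** * The operations d, v and t *)

Lemma d_closure : closure_op (@d_op D).
Proof. by split=> [E []|E _ x|A E z x _ _ Ax|x] //; apply. Qed.

Lemma d_finite_type : finite_type (@d_op D).
Proof.
move=> E x EF Ex; have [|F [Ff FE Fx]] := @fg_containing E [:: x] EF.
  by move=> y; rewrite inE => /eqP ->.
by exists F; split=> //; apply: Fx; rewrite inE.
Qed.

Lemma d_stable : stable (@d_op D).
Proof. by move=> E x _ Ex; split; [exact: base1|rewrite mul1r]. Qed.

Lemma v_trans A E z x : v_op A x -> (forall a, A a -> v_op E (z * a)) ->
  v_op E (z * x).
Proof.
move=> Ax AE e Ee; rewrite mulrAC mulrC; apply: Ax => a Aa.
by rewrite mulrAC; exact: AE.
Qed.

Lemma v_closure : closure_op (@v_op D).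
Proof.
split=> [E _|E _ x Ex e Ee|A E z x _ _|x xb]; first exact: invm_submodule.
- by rewrite mulrC; exact: Ee.
- exact: v_trans.
- by rewrite -[x]mulr1; apply: xb => y; rewrite mul1r.
Qed.

Lemma t_fg F : fg F -> t_op F = v_op F.
Proof.
move=> Ff; apply/seteqP; split=> [x [G [Gf GF]]|x Fx]; last first.
  by exists F; [split|].
exact: closure_mono v_closure (fg_Fbar Gf) (fg_Fbar Ff) GF x.
Qed.

Lemma t_sub_v E : Fbar E -> t_op E `<=` v_op E.
Proof.
by move=> EF x [F [Ff FE]]; exact: closure_mono v_closure (fg_Fbar Ff) EF FE x.
Qed.

(** The modules G^v, for G finitely generated inside E, form a directed family
with union E^t, so finitely many elements of E^t share one G. *)
Lemma t_cover E s z : Fbar E -> (forall a, a \in s -> t_op E (z * a)) ->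
  exists G, [/\ fg G, G `<=` E & forall a, a \in s -> v_op G (z * a)].
Proof.
move=> EF sE.
pose C := [set A | exists G, [/\ fg G, G `<=` E & A = v_op G]].
have [|A B [F [Ff FE ->]] [G [Gf GE ->]]|y|A [G [Gf GE ->]] sG] :=
    @seq_directed C [seq z * a | a <- s].
- have [//|F [Ff FE _]] := @fg_containing E [::] EF.
  by exists (v_op F), F.
- have [H [Hf HE FH GH]] := fg_directed EF Ff Gf FE GE.
  exists (v_op H); split; first by exists H.
    exact: closure_mono v_closure (fg_Fbar Ff) (fg_Fbar Hf) FH.
  exact: closure_mono v_closure (fg_Fbar Gf) (fg_Fbar Hf) GH.
- move=> /mapP[a /sE [F [Ff FE] Fa] ->]; exists (v_op F) => //.
  by exists F.
- by exists G; split=> // a as_; apply: sG; apply: map_f.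
Qed.

Lemma t_closure : closure_op (@t_op D).
Proof.
split=> [E EF|E EF x Ex|A E z x AF EF [F [Ff FA] Fx] AE|x xb].
- have dir x y : t_op E x -> t_op E y ->
      exists G, [/\ fg G, G `<=` E, v_op G x & v_op G y].
    move=> Ex Ey; have [|G [Gf GE sG]] := @t_cover E [:: x; y] 1 EF.
      by move=> a; rewrite !inE mul1r => /orP[] /eqP ->.
    by exists G; split=> //; rewrite -[X in v_op _ X]mul1r; apply: sG;
      rewrite !inE eqxx ?orbT.
  split=> [|x y Ex Ey|a x [F [Ff FE] Fx]].
  + have [//|F [Ff FE _]] := @fg_containing E [::] EF.
    by exists F => //; have [] := invm_submodule (invm F).
  + have [G [Gf GE Gx Gy]] := dir x y Ex Ey; exists G => //.
    by have [_ GD _] := invm_submodule (invm G); exact: GD.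
  + by exists F => //; have [_ _ FZ] := invm_submodule (invm F); exact: FZ.
- have [|F [Ff FE Fx]] := @fg_containing E [:: x] EF.
    by move=> y; rewrite inE => /eqP ->.
  exists F => //; have [_ ext _ _] := v_closure.
  by apply: ext; [exact: fg_Fbar|apply: Fx; rewrite inE].
- have [_ [s FE]] := Ff.
  have [|G [Gf GE sG]] := @t_cover E s z EF.
    by move=> a as_; apply/AE/FA; rewrite FE; exact: sub_span.
  exists G => //; apply: v_trans Fx _; rewrite FE.
  apply: (@span_sub _ [set a | v_op G (z * a)]) => //.
  exact/submodule_transport/invm_submodule.
- by move: xb; rewrite (t_fg base_fg); have [_ _ _] := v_closure; apply.
Qed.

Lemma t_finite_type : finite_type (@t_op D).
Proof.
by move=> E x _ [F [Ff FE] Fx]; exists F; split=> //; exists F; [split|].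
Qed.

(** If y F F^-1 lies in D, then y F^v lies in F^v, which is (DF)^v. *)
Lemma t_cancel_invertible F : cancellative (@t_op D) -> fg F ->
  v_op (mulm F (invm F)) 1.
Proof.
move=> cancel Ff y yF; have [Fs _] := fg_Fbar Ff; rewrite mul1r.
have [_ _ _ base_closed] := t_closure; apply: base_closed.
apply: (cancel base F base_fg Ff) => z; rewrite mulm_base // t_fg //.
move=> /v_trans; apply=> f Ff' e Fe.
by rewrite -mulrA; apply: yF; exact: mulmI.
Qed.

Lemma t_cancellativeP : cancellative (@t_op D) <-> v_domain D.
Proof.
split=> [cancel F Ff|vdom F H Ff Hf x xH].
  apply/(closure_eq_baseP v_closure (mulm_invm_Fbar Ff) (@mulm_invm_sub F)).
  exact: t_cancel_invertible.
rewrite t_fg //; apply: (invertible_cancel v_closure Ff Hf) => [|h Hh].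
  by rewrite (vdom H Hf); exact: base1.
apply: t_sub_v; first exact: mulm_Fbar (fg_Fbar Ff) (fg_Fbar Hf).
by apply: xH; have [_ ext _ _] := t_closure; exact: ext (fg_Fbar Hf) _ Hh.
Qed.

(** * Maximal t-ideals and the operation w *)

Lemma t_idealP I : t_ideal I <->
  [/\ Fbar I, I `<=` base, ~ I 1 & t_op I `<=` I].
Proof.
have [_ ext _ _] := t_closure.
split=> [[IF Ib Inb tI]|[IF Ib I1 tI]]; split=> //.
- move=> I1; apply: Inb; apply/seteqP; split=> // x bx; rewrite -[x]mulr1.
  by case: IF => Is _; exact: submoduleM.
- by rewrite tI.
- by move=> Ib'; apply: I1; rewrite Ib'; exact: base1.
- by apply/seteqP; split=> //; exact: ext.
Qed.

(** The t-closure is of finite type, and a finitely generated submodule of the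
union is already contained in a member of the chain. *)
Lemma t_ideal_bigcup (C : set (set K)) I : C I ->
  C `<=` t_ideal (D := D) -> total_on C subset -> t_ideal (\bigcup_(X in C) X).
Proof.
move=> CI Ct Ctot.
have CP X : C X -> [/\ Fbar X, X `<=` base, ~ X 1 & t_op X `<=` X].
  by move=> /Ct/t_idealP.
apply/t_idealP; split.
- split; last first.
    by have [[_ [x Ix x0]] _ _ _] := CP I CI; exists x => //; exists I.
  split=> [|x y [X CX Xx] [Y CY Yy]|a x [X CX Xx]].
  + by exists I => //; have [[[]]] := CP I CI.
  + have [XY|YX] := Ctot X Y CX CY.
      have [[[_ YD _] _] _ _ _] := CP Y CY.
      by exists Y => //; exact: YD (XY _ Xx) Yy.
    have [[[_ XD _] _] _ _ _] := CP X CX.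
    by exists X => //; exact: XD Xx (YX _ Yy).
  + by exists X => //; have [[[_ _ XZ] _] _ _ _] := CP X CX; exact: XZ.
- by move=> x [X CX Xx]; have [_ Xb _ _] := CP X CX; exact: Xb.
- by move=> [X CX X1]; have [_ _ nX1 _] := CP X CX.
move=> x [F [Ff FU] Fx]; have [_ [s FE]] := Ff.
have [|A B CA CB|y ys|X CX sX] := @seq_directed C s.
- by exists I.
- by have [AB|BA] := Ctot A B CA CB; [exists B|exists A]; split.
- by have [X CX Xy] : (\bigcup_(X in C) X) y;
    [apply: FU; rewrite FE; exact: sub_span|exists X].
have [[Xs _] _ _ tX] := CP X CX; exists X => //; apply: tX; exists F => //.
by split=> //; rewrite FE; exact: span_sub.
Qed.

Lemma Max_t_above I : Fbar I -> I `<=` base -> ~ t_op I 1 ->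
  exists2 Q, Max_t Q & I `<=` Q.
Proof.
move=> IF Ib I1; have [sub ext trans _] := t_closure.
have tIt : t_ideal (t_op I).
  have tIF : Fbar (t_op I).
    split; first exact: sub.
    by have [_ [x Ix x0]] := IF; exists x => //; exact: ext.
  apply/t_idealP; split=> // x.
    move/(closure_mono t_closure IF base_Fbar Ib).
    by have [_ _ _] := t_closure; apply.
  move=> ttIx; rewrite -[x]mul1r; apply: (trans _ _ _ _ tIF IF ttIx) => a.
  by rewrite mul1r.
(* the empty set is allowed in order to bound the empty chain *)
pose P X := X = set0 \/ t_ideal X /\ t_op I `<=` X.
have [C CP Ctot|Q [PQ Qmax]] := @Zorn_bigcup _ P.
  have [[X CX [x Xx]]|C0] := pselect (exists2 X, C X & X !=set0); last first.
    left; apply/seteqP; split=> // x [X CX Xx]; apply: C0; exists X => //.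
    by exists x.
  pose C' := [set Y | C Y /\ Y !=set0].
  have C'E : \bigcup_(Y in C) Y = \bigcup_(Y in C') Y.
    apply/seteqP; split=> y [Y CY Yy]; exists Y => //; last by case: CY.
    by split=> //; exists y.
  have C'P Y : C' Y -> t_ideal Y /\ t_op I `<=` Y.
    by move=> [/CP[->|//] [y]].
  have C'X : C' X by split=> //; exists x.
  right; rewrite C'E; split.
    apply: (t_ideal_bigcup C'X) => [Y /C'P[]//|Y Z [CY _] [CZ _]].
    exact: Ctot.
  by move=> y Iy; exists X => //; have [_] := C'P X C'X; apply.
have Qt : t_ideal Q /\ t_op I `<=` Q.
  case: PQ => // Q0; case: (Qmax (t_op I)); last by right; split.
  rewrite Q0; split=> // I0; have [_ [x Ix _]] := IF.
  by apply: (I0 x); exact: ext.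
have [Qtid IQ] := Qt.
exists Q; last by move=> x /(ext I IF); exact: IQ.
split=> // J Jt QJ; apply/seteqP; split=> //; apply: contrapT => JQ.
by apply: (Qmax J) => //; right; split=> // x /IQ; exact: QJ.
Qed.

Section MaximalTIdeal.
Variables (Q : set K) (Qmax : Max_t Q).

Lemma Max_tP : [/\ Fbar Q, Q `<=` base, ~ Q 1 & t_op Q `<=` Q].
Proof. by apply/t_idealP; case: Qmax. Qed.

(** If a is outside Q, the conductor of Q with respect to a is a proper t-ideal
containing Q, hence equal to Q by maximality. *)
Lemma Max_t_prime a b : base a -> base b -> ~ Q a -> ~ Q b -> ~ Q (a * b).
Proof.
have [QF Qb Q1 tQ] := Max_tP; have [Qs _] := QF.
have [_ ext trans base_closed] := t_closure.
move=> ba bb Qa Qnb Qab; apply: Qnb.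
have Q'F := conductor_Fbar a QF.
have <- : conductor Q a = Q.
  have [_ maxQ] := Qmax; apply: maxQ; last first.
    move=> q Qq; split; first exact: Qb.
    by rewrite mulrC; exact: submoduleM.
  apply/t_idealP; split=> // [d []//|[_]|x Q'x]; first by rewrite mul1r.
  split.
    apply/base_closed/(closure_mono t_closure Q'F base_Fbar _ Q'x).
    by move=> d [].
  apply: tQ; rewrite mulrC; apply: trans Q'x _ => // d [_ Qda].
  by apply: ext => //; rewrite mulrC.
by split=> //; rewrite mulrC.
Qed.

Lemma mulm_localizeP E x : submodule E ->
  mulm E (localize Q) x <-> exists s : K, [/\ base s, ~ Q s & E (s * x)].
Proof.
move=> Es; have [E0 ED EZ] := Es; have [[[Q0 _ _] _] _ Q1 _] := Max_tP.
have [_ bD bZ] := base_submodule; split=> [|[_ [[s _ <-] Qs Esx]]]; last first.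
  have s0 : s%:F != 0 :> K by apply/eqP => s0; apply: Qs; rewrite s0.
  rewrite -[x](mulKf s0) mulrC; apply: mulmI => //.
  by exists 1, s; split=> //; rewrite tofrac1 mul1r.
move: x; pose U := [set x | exists s : K, [/\ base s, ~ Q s & E (s * x)]].
apply: (@mulm_sub _ _ U) => [|e _ Ee [a [s [Qs ->]]]]; last first.
  have s0 : s%:F != 0 :> K by apply/eqP => s0; apply: Qs; rewrite s0.
  exists s%:F; split=> //; first by exists s.
  by rewrite mulrCA [_ * (_ / _)]mulrC mulfVK // mulrC; exact: EZ.
split=> [|x y [s [bs Qs Ex]] [t [bt Qt Ey]]|a x [s [bs Qs Ex]]].
- by exists 1; split=> //; [exact: base1|rewrite mulr0].
- exists (s * t); split; first exact: submoduleM base_submodule bs bt.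
    exact: Max_t_prime.
  rewrite mulrDr; apply: ED; last by rewrite -mulrA; exact: submoduleM.
  by rewrite [s * t]mulrC -mulrA; exact: submoduleM.
- by exists s; split=> //; rewrite mulrCA; exact: EZ.
Qed.

End MaximalTIdeal.

Lemma w_opP E x : submodule E ->
  w_op E x <->
  (forall Q, Max_t Q -> exists s : K, [/\ base s, ~ Q s & E (s * x)]).
Proof.
move=> Es; split=> Ex Q Qm; last exact/(mulm_localizeP Qm x Es)/(Ex Q Qm).
by apply/(mulm_localizeP Qm x Es); exact: Ex.
Qed.

(** Each side says that I is contained in no maximal t-ideal. *)
Lemma w_t_dense I : Fbar I -> I `<=` base -> w_op I 1 <-> t_op I 1.
Proof.
move=> IF Ib; have [Is _] := IF; split=> [/(w_opP _ Is) I1|I1].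
  apply: contrapT => /(Max_t_above IF Ib)[Q /I1[s [bs Qs Is1]] IQ].
  by apply: Qs; apply: IQ; rewrite -[s]mulr1.
apply/(w_opP _ Is) => Q Qm; have [QF _ Q1 tQ] := Max_tP Qm.
apply: contrapT => IQ; apply: Q1; apply: tQ.
apply: (closure_mono t_closure IF QF _ I1) => s sI; apply: contrapT => Qs.
by apply: IQ; exists s; split=> //; [exact: Ib|rewrite mulr1].
Qed.

(** An element s outside Q with s x in E lies in the conductor itself. *)
Lemma w_stable : stable (@w_op D).
Proof.
move=> E x EF; have [Es _] := EF; have [cs _] := conductor_Fbar x EF.
move=> /(w_opP _ Es) Ex; apply/(w_opP _ cs) => Q /Ex[s [bs Qs Esx]].
by exists s; rewrite mulr1.
Qed.

Lemma w_conductor_t E x : Fbar E -> w_op E x -> t_op (conductor E x) 1.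
Proof.
move=> EF Ex; apply/w_t_dense; [exact: conductor_Fbar|by move=> d []|].
exact: w_stable.
Qed.

Lemma w_closure : closure_op (@w_op D).
Proof.
split=> [E [Es _]|E [Es _] x Ex|A E z x [As _] [Es _]|x].
- have sQ Q : submodule (mulm E (localize Q)) by exact: submodule_span.
  split=> [Q Qm|x y Ex Ey Q Qm|a x Ex Q Qm]; have [Q0 QD QZ] := sQ Q => //.
    by apply: QD; [exact: Ex|exact: Ey].
  by apply: QZ; exact: Ex.
- apply/(w_opP _ Es) => Q Qm; exists 1; have [_ _ Q1 _] := Max_tP Qm.
  by split=> //; [exact: base1|rewrite mul1r].
- move=> /(w_opP _ As) Ax AE; apply/(w_opP _ Es) => Q Qm.
  have [s [bs Qs Asx]] := Ax Q Qm.
  have [t [bt Qt Etzsx]] := (w_opP _ Es).1 (AE _ Asx) Q Qm.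
  exists (t * s); split; first exact: submoduleM base_submodule bt bs.
    exact: Max_t_prime.
  by rewrite -mulrA (mulrCA s z).
(* some finitely generated F with x F inside D has 1 in F^v, and then x, being
   in F^-1, is in D *)
- move=> /(w_conductor_t base_Fbar)[F [Ff FI] F1]; rewrite -[x]mul1r.
  by apply: F1 => d /FI[_]; rewrite mulrC.
Qed.

(** The conductor of E with respect to x is dense for t, which is of finite
type, so it contains a finitely generated dense ideal J; then x J lies in E and
x in (x J)^w. *)
Lemma w_finite_type : finite_type (@w_op D).
Proof.
move=> E x EF Ex; have [J [Jf JI] J1] := w_conductor_t EF Ex.
have [_ [s JE]] := Jf; have [_ ext _ _] := w_closure.
have sJ y : y \in s -> J y by move=> ys; rewrite JE; exact: sub_span.
have [y|F [Ff FE sF]] := @fg_containing E [seq x * y | y <- s] EF.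
  by move=> /mapP[d /sJ/JI[_ Edx] ->]; rewrite mulrC.
exists F; split=> //; have FF := fg_Fbar Ff; have [Fs _] := FF.
apply: (closure_dense w_closure (fg_Fbar Jf) FF).
  apply/w_t_dense; [exact: fg_Fbar|by move=> d /JI[]|by exists J; [split|]].
move=> a Ja; apply: ext => //; move: a Ja; rewrite JE.
apply: (@span_sub _ [set a | F (x * a)]); first exact: submodule_transport.
by move=> a /= as_; apply: sF; apply: map_f.
Qed.

End FinitelyGenerated.

Theorem lemma25 (D : idomainType) :
  [/\ semistar_eq (d_op (D := D)) (a_op d_op) <-> prufer_domain D,
      semistar_eq (w_op (D := D)) (a_op w_op) <-> pvmd D
    & semistar_eq (t_op (D := D)) (a_op t_op) <-> v_domain D].
Proof.
split.
- rewrite (semistar_eq_a_opP (@d_closure D) (@d_finite_type D)).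
  rewrite (stable_cancellativeP (@d_closure D) (@d_stable D)).
  by split=> H F Ff; apply/(closure_eq_baseP (@d_closure D)
    (mulm_invm_Fbar Ff) (@mulm_invm_sub D F)); exact: H.
- rewrite (semistar_eq_a_opP (@w_closure D) (@w_finite_type D)).
  rewrite (stable_cancellativeP (@w_closure D) (@w_stable D)).
  split=> H F Ff.
    apply/(closure_eq_baseP (@t_closure D)
      (mulm_invm_Fbar Ff) (@mulm_invm_sub D F)).
    by apply/(w_t_dense (mulm_invm_Fbar Ff) (@mulm_invm_sub D F)); exact: H.
  apply/(w_t_dense (mulm_invm_Fbar Ff) (@mulm_invm_sub D F)).
  by rewrite (H F Ff); exact: base1.
- rewrite (semistar_eq_a_opP (@t_closure D) (@t_finite_type D)).
  exact: t_cancellativeP.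
Qed.
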